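(* Let $G=\mathbb{R}^{m}\ltimes_{\phi}\mathbb{R}^{n}$ be a semidirect product such that $\phi$ is a semi-simple action, and let $\mathfrak{g}$ be its Lie algebra. Suppose that $\dim[G,G]>\frac{\dim G}{2}$, that $G$ has a lattice $\Gamma$ and a left-invariant complex structure $J$, and that $b_{1}(G/\Gamma)=b_{1}(\mathfrak{g})$. Then $(G/\Gamma,J)$ admits no Vaisman metric (left-invariant or not).
   Context: Here $\phi:\mathbb{R}^{m}\to \mathrm{Aut}(\mathbb{R}^{n})=GL(n,\mathbb{R})$ is a Lie group homomorphism; it is a semi-simple action if $\mathbb{R}^{n}$ is a completely reducible $\mathbb{R}^{m}$-module via $\phi$ (equivalently $\phi(\mathbb{R}^m)$ is simultaneously diagonalizable over $\mathbb{C}$). A lattice is a cocompact discrete subgroup. $G/\Gamma$ denotes the compact quotient of $G$ by the left-translation action of $\Gamma$, so that left-invariant forms, vector fields and complex structures on $G$ descend to $G/\Gamma$. $b_1(G/\Gamma)=\dim H^1(G/\Gamma)$ is the first Betti number and $b_1(\mathfrak{g})=\dim H^1(\mathfrak{g})$, where $H^*(\mathfrak{g})$ is the cohomology of the complex $(\bigwedge\mathfrak{g}^*,d)$ of left-invariant forms. A Hermitian metric $g$ on a complex manifold $(M,J)$, with fundamental form $\omega=g(-,J-)$, is locally conformal Kähler (LCK) if there is a closed $1$-form $\theta$ (the Lee form) with $d\omega=\theta\wedge\omega$; it is always assumed that $\theta\neq 0$ and that $\theta$ is not exact. An LCK metric $g$ is Vaisman if $\nabla\theta=0$ for the Levi-Civita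 connection $\nabla$ of $g$. *)

(* Defs.v *)
From HB Require Import structures.
From mathcomp Require Import all_boot all_order all_algebra generic_quotient.
From mathcomp Require Import all_classical all_reals all_analysis.

Set Implicit Arguments.
Unset Strict Implicit.
Unset Printing Implicit Defensive.

Import Order.TTheory GRing.Theory Num.Theory.
Import numFieldNormedType.Exports.

Local Open Scope classical_set_scope.
Local Open Scope ring_scope.

(* Tensor fields on G/Gamma are represented by Gamma-invariant tensor fields on
   the covering manifold G, which is the vector space R^m x R^n: tangent spaces
   are identified with G itself through the global linear coordinates.  A 1-form
   is alpha : G -> G -> R with alpha p u linear in the tangent vector u, and
   similarly for metrics and endomorphism fields.  Since G/Gamma is the quotient
   by left translations, "Gamma-invariant" refers to p |-> a p for a in Gamma,
   and "left-invariant" is the case Gamma = G. *)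

Section Smooth.
Context {R : realType} {V W : normedModType R}.

(* Meant for finite-dimensional V, where the continuity (resp. the
   differentiability) of v |-> df(v) may be tested for each v separately. *)
Fixpoint Ck (k : nat) (f : V -> W) : Prop :=
  if k is k'.+1 then
    (forall p, differentiable f p) /\ (forall v, Ck k' ('D_v f))
  else continuous f.

Definition smooth (f : V -> W) : Prop := forall k, Ck k f.

End Smooth.

Section LinearAlgebra.
Context {R : realType}.

Definition has_dim (V : vectType R) (S : set V) (k : nat) : Prop :=
  exists2 U : {vspace V}, (forall v, v \in U <-> S v) & \dim U = k.

(* dim (Z / B) = k: k elements of Z whose classes are a basis of Z / B. *)
Definition has_quotient_dim (V : lmodType R) (Z B : set V) (k : nat) : Prop :=
  exists e : 'I_k -> V,
    [/\ forall i, Z (e i),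
        forall c : 'I_k -> R, B (\sum_i c i *: e i) -> forall i, c i = 0 &
        forall z, Z z -> exists c : 'I_k -> R, B (z - \sum_i c i *: e i)].

End LinearAlgebra.

Notation semidirect R m n := ('cV[R]_m * 'cV[R]_n)%type.

Section SemidirectProduct.
Context {R : realType} {m n : nat} (phi : 'cV[R]_m -> 'M[R]_n).
Local Notation G := (semidirect R m n).

Definition lie_action : Prop :=
  [/\ smooth phi,
      forall t, phi t \in unitmx &
      forall s t, phi (s + t) = phi s *m phi t].

Definition invariant_subspace (U : {vspace 'cV[R]_n}) : Prop :=
  forall t x, x \in U -> phi t *m x \in U.

Definition semisimple_action : Prop :=
  forall U, invariant_subspace U ->
    exists W, [/\ invariant_subspace W, (U + W)%VS = fullv &
                  (U :&: W)%VS = 0%VS].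

Definition smul (a b : G) : G := (a.1 + b.1, a.2 + phi a.1 *m b.2).
Definition sinv (a : G) : G := (- a.1, - (phi (- a.1) *m a.2)).
Definition scomm (a b : G) : G := smul (smul a b) (smul (sinv a) (sinv b)).

Definition subgroup (H : set G) : Prop :=
  [/\ H 0, forall a b, H a -> H b -> H (smul a b) &
      forall a, H a -> H (sinv a)].

Definition commutator_subgroup : set G :=
  [set p | forall H, subgroup H -> (forall a b, H (scomm a b)) -> H p].

(* The Lie algebra of a Lie subgroup H, inside T_0 G: velocities of the
   one-parameter subgroups contained in H. *)
Definition lie_of_subgroup (H : set G) : set G :=
  [set X | exists c : R -> G,
    [/\ smooth c, forall s t, c (s + t) = smul (c s) (c t),
        forall t, H (c t) & 'D_1 c 0 = X]].

Definition lie_subgroup_dim (H : set G) (k : nat) : Prop :=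
  has_dim (lie_of_subgroup H) k.

(* p and q are identified when Gamma p = Gamma q; this is an equivalence
   relation for any set Gamma. *)
Section Quotient.
Variable Gamma : set G.

Definition same_orbit : rel G :=
  fun p q => smul^~ p @` Gamma == smul^~ q @` Gamma.

Lemma same_orbit_refl : reflexive same_orbit.
Proof. by move=> p; rewrite /same_orbit eqxx. Qed.

Lemma same_orbit_sym : symmetric same_orbit.
Proof. by move=> p q; rewrite /same_orbit eq_sym. Qed.

Lemma same_orbit_trans : transitive same_orbit.
Proof. by move=> q p r /eqP pq /eqP qr; rewrite /same_orbit pq qr. Qed.

Definition orbit_equiv :=
  EquivRel same_orbit same_orbit_refl same_orbit_sym same_orbit_trans.

End Quotient.

Definition lattice (Gamma : set G) : Prop :=
  [/\ subgroup Gamma, Gamma `<=` isolated Gamma &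
      compact [set: quotient_topology {eq_quot orbit_equiv Gamma}%qT]].

(* The differential at p of the left translation by a. *)
Definition dtrans (a p u : G) : G := 'D_u (smul a) p.

(* The exterior derivatives of forms are written out on constant vector
   fields. *)

Definition is_form1 (alpha : G -> G -> R) : Prop :=
  (forall p, scalar (alpha p)) /\ (forall u, smooth (alpha^~ u)).

Definition invariant_form1 (Gamma : set G) (alpha : G -> G -> R) : Prop :=
  forall a p u, Gamma a -> alpha (smul a p) (dtrans a p u) = alpha p u.

Definition ext_d1 (alpha : G -> G -> R) (p u v : G) : R :=
  'D_u (alpha^~ v) p - 'D_v (alpha^~ u) p.

Definition ext_d2 (omega : G -> G -> G -> R) (p u v w : G) : R :=
  'D_u (fun q => omega q v w) p - 'D_v (fun q => omega q u w) p
  + 'D_w (fun q => omega q u v) p.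

Definition wedge12 (theta : G -> G -> R) (omega : G -> G -> G -> R)
    (p u v w : G) : R :=
  theta p u * omega p v w - theta p v * omega p u w + theta p w * omega p u v.

Definition closed_form1 (Gamma : set G) : set (G -> G -> R) :=
  [set alpha | [/\ is_form1 alpha, invariant_form1 Gamma alpha &
                   forall p u v, ext_d1 alpha p u v = 0]].

Definition exact_form1 (Gamma : set G) : set (G -> G -> R) :=
  [set alpha | exists f : G -> R,
    [/\ smooth f, forall a p, Gamma a -> f (smul a p) = f p &
        forall p u, alpha p u = 'D_u f p]].

(* dim H^1 of the complex of Gamma-invariant forms on G: for a lattice Gamma
   this is the de Rham b_1(G/Gamma), and for Gamma = G it is b_1(g), the complex
   being that of left-invariant forms. *)
Definition betti1 (Gamma : set G) (k : nat) : Prop :=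
  has_quotient_dim (V := (G -> G -> R^o))
    (closed_form1 Gamma) (exact_form1 Gamma) k.

Definition lie_bracket (X Y : G -> G) (p : G) : G :=
  'D_(X p) Y p - 'D_(Y p) X p.

Definition appJ (J : G -> G -> G) (X : G -> G) (p : G) : G := J p (X p).

Definition nijenhuis (J : G -> G -> G) (X Y : G -> G) (p : G) : G :=
  lie_bracket X Y p
  + J p (lie_bracket (appJ J X) Y p) + J p (lie_bracket X (appJ J Y) p)
  - lie_bracket (appJ J X) (appJ J Y) p.

(* An integrable almost complex structure (Newlander-Nirenberg). *)
Definition complex_structure (J : G -> G -> G) : Prop :=
  [/\ forall p, linear (J p),
      forall u, smooth (J^~ u),
      forall p u, J p (J p u) = - u &
      forall X Y, smooth X -> smooth Y -> forall p, nijenhuis J X Y p = 0].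

Definition left_invariant_endo (J : G -> G -> G) : Prop :=
  forall a p u, J (smul a p) (dtrans a p u) = dtrans a p (J p u).

Definition riemannian_metric (g : G -> G -> G -> R) : Prop :=
  [/\ forall p u, scalar (g p u),
      forall p u v, g p u v = g p v u,
      forall p u, u != 0 -> 0 < g p u u &
      forall u v, smooth (fun p => g p u v)].

Definition invariant_metric (Gamma : set G) (g : G -> G -> G -> R) : Prop :=
  forall a p u v, Gamma a ->
    g (smul a p) (dtrans a p u) (dtrans a p v) = g p u v.

Definition hermitian_metric (Gamma : set G) (J : G -> G -> G)
    (g : G -> G -> G -> R) : Prop :=
  [/\ riemannian_metric g, invariant_metric Gamma g &
      forall p u v, g p (J p u) (J p v) = g p u v].

Definition fundamental_form (J : G -> G -> G) (g : G -> G -> G -> R)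
    (p u v : G) : R := g p u (J p v).

Definition affine_connection (nabla : (G -> G) -> (G -> G) -> G -> G) : Prop :=
  [/\ forall X Y, smooth X -> smooth Y -> smooth (nabla X Y),
      forall (f : G -> R) X X' Y,
        smooth f -> smooth X -> smooth X' -> smooth Y -> forall p,
        nabla (fun q => f q *: X q + X' q) Y p
        = f p *: nabla X Y p + nabla X' Y p,
      forall X Y Y', smooth X -> smooth Y -> smooth Y' -> forall p,
        nabla X (fun q => Y q + Y' q) p = nabla X Y p + nabla X Y' p &
      forall (f : G -> R) X Y, smooth f -> smooth X -> smooth Y -> forall p,
        nabla X (fun q => f q *: Y q) p
        = f p *: nabla X Y p + 'D_(X p) f p *: Y p].

Definition levi_civita (g : G -> G -> G -> R)
    (nabla : (G -> G) -> (G -> G) -> G -> G) : Prop :=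
  [/\ affine_connection nabla,
      forall X Y, smooth X -> smooth Y -> forall p,
        nabla X Y p - nabla Y X p = lie_bracket X Y p &
      forall X Y Z, smooth X -> smooth Y -> smooth Z -> forall p,
        'D_(X p) (fun q => g q (Y q) (Z q)) p
        = g p (nabla X Y p) (Z p) + g p (Y p) (nabla X Z p)].

(* (nabla_X theta)(Y) = X(theta(Y)) - theta(nabla_X Y) *)
Definition parallel_form1 (nabla : (G -> G) -> (G -> G) -> G -> G)
    (theta : G -> G -> R) : Prop :=
  forall X Y, smooth X -> smooth Y -> forall p,
    'D_(X p) (fun q => theta q (Y q)) p - theta p (nabla X Y p) = 0.

Definition lck_metric (Gamma : set G) (J : G -> G -> G)
    (g : G -> G -> G -> R) (theta : G -> G -> R) : Prop :=
  let omega := fundamental_form J g in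
  [/\ hermitian_metric Gamma J g,
      closed_form1 Gamma theta,
      exists p u, theta p u != 0,
      ~ exact_form1 Gamma theta &
      forall p u v w, ext_d2 omega p u v w = wedge12 theta omega p u v w].

Definition vaisman_metric (Gamma : set G) (J : G -> G -> G)
    (g : G -> G -> G -> R) : Prop :=
  exists theta nabla,
    [/\ lck_metric Gamma J g theta, levi_civita g nabla &
        parallel_form1 nabla theta].

End SemidirectProduct.

(* Main.v *)
Require Import Defs.
From HB Require Import structures.
From mathcomp Require Import all_boot all_order all_algebra generic_quotient.
From mathcomp Require Import all_classical all_reals all_analysis.
From mathcomp Require Import lra.

Set Implicit Arguments.
Unset Strict Implicit.
Unset Printing Implicit Defensive.

Import Order.TTheory GRing.Theory Num.Theory.
Import numFieldNormedType.Exports.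

Local Open Scope classical_set_scope.
Local Open Scope ring_scope.

(** Suppose that a Vaisman metric has Lee form [theta], with dual vector field
    [B] and fundamental form [omega].

    As the two Betti numbers agree, [theta = theta0 + df] with [theta0] closed
    and left-invariant and [f] a function on the compact quotient
    ([cohomologous_invariant]); [theta0] is nonzero because [theta] is not
    exact. The Lie algebra of [G, G] lies in the abelian ideal [R^n] and is
    killed by [theta0] ([lie_commutator_fst], [lie_commutator_form]). Having
    more than half the dimension of [G], it contains some [X <> 0] together
    with [J X] ([stable_pair]).

    The Vaisman condition gives
    [d (theta \o J) = theta /\ (theta \o J) - |B|^2 omega]
    ([vaisman_dthetaJ]). Let [u] and [v = J u] be the values of [X] and [J X],
    seen as left-invariant fields, at a point [p]. These fields commute,
    [theta0] vanishes on them, and [theta] is the differential of [f] along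
    them, so the identity evaluated on them reads
    [- (f_uu + f_vv) = - (f_u ^ 2 + f_v ^ 2) + |B|^2 |u|^2].

    At a point [p] where [f] is minimal, which exists by compactness, [df]
    vanishes, so that [theta] coincides with [theta0] there and [B] does not
    vanish; the right-hand side is positive. But the second derivatives of [f]
    are nonnegative at a minimum ([derive2_min]): a contradiction. *)

(** * Directional derivatives and smooth maps *)

Section Lines.
Context {R : realType} {V W : normedModType R}.

Lemma is_derive_line (f : V -> W) (p u : V) (s : R) :
  derivable f (p + s *: u) u ->
  is_derive s 1 (fun t : R => f (p + t *: u)) ('D_u f (p + s *: u)).
Proof.
have E : (fun h : R => h^-1 *: (((fun t => f (p + t *: u)) \o shift s) (h *: 1)
             - f (p + s *: u)))
       = (fun h => h^-1 *: ((f \o shift (p + s *: u)) (h *: u)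
             - f (p + s *: u))).
  apply/funext => h /=; congr (_ *: (f _ - _)).
  by rewrite [h *: 1]mulr1 scalerDl addrCA.
by move=> df; apply: DeriveDef; rewrite /derivable /derive E.
Qed.

Lemma derive_line_eq (f g : V -> W) (p u : V) :
  (forall s : R, f (p + s *: u) = g (p + s *: u)) -> 'D_u f p = 'D_u g p.
Proof.
have E k : (fun h : R => h^-1 *: ((k \o shift p) (h *: u) - k p))
       = (fun h => h^-1 *: (k (p + h *: u) - k (p + 0 *: u))).
  by apply/funext => h /=; rewrite [_ + p]addrC scale0r addr0.
by move=> fg; rewrite /derive !E; under eq_fun do rewrite !fg.
Qed.

Lemma derive_affine (f : V -> W) (p u : V) (w : W) :
  (forall s : R, f (p + s *: u) = f p + s *: w) -> 'D_u f p = w.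
Proof.
move=> fE; apply/lim_near_cst => //.
near=> h => /=; rewrite [_ + p]addrC fE addrC addKr scalerA mulVf ?scale1r //.
by near: h; exact: nbhs_dnbhs_neq.
Unshelve. all: by end_near. Qed.

End Lines.

Section Minimum.
Context {R : realType} {V : normedModType R}.

(** Only the restriction of [f] to the line through [p] directed by [u] is
    involved, so Fermat's rule in one variable suffices. *)
Lemma derive_min (f : V -> R) (p u : V) :
  (forall q, derivable f q u) -> (forall q, f p <= f q) -> 'D_u f p = 0.
Proof.
move=> df fmin.
have D (s : R) :
    is_derive s 1 (fun t : R => f (p + t *: u)) ('D_u f (p + s *: u)).
  exact: is_derive_line.
have := @derive1_at_min R (fun t : R => f (p + t *: u)) (-1) 1 0.
case.
- by lra.
- by move=> t _; have := D t.
- by rewrite in_itv /= ltrN10 ltr01.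
- by move=> t _; rewrite scale0r addr0.
by have := D 0; rewrite scale0r addr0 => -[_ ->].
Qed.

(** Were the second derivative negative, the first derivative, which vanishes
    at [p], would be negative just after [p], and the mean value theorem would
    produce a value of [f] below the minimum. *)
Lemma derive2_min (f : V -> R) (p u : V) :
  (forall q, derivable f q u) -> (forall q, derivable ('D_u f) q u) ->
  (forall q, f p <= f q) -> 0 <= 'D_u ('D_u f) p.
Proof.
move=> df d2f fmin; rewrite leNgt; apply/negP => D2neg.
have D10 := derive_min df fmin.
pose F (t : R) := f (p + t *: u).
have D (s : R) : is_derive s 1 F ('D_u f (p + s *: u)) by exact: is_derive_line.
have : \forall h \near 0^', h^-1 *: ('D_u f (h *: u + p) - 'D_u f p) < 0.
  by apply: (@cvgr_lt _ _ _ _ _ _ (d2f p) 0 D2neg).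
move=> [e /= e0 He].
have e20 : 0 < e / 2 by rewrite divr_gt0.
have [c cI Fc] : exists2 c, c \in `]0, e / 2[%R &
    F (e / 2) - F 0 = 'D_u f (p + c *: u) * (e / 2 - 0).
  apply: MVT => //; apply: derivable_within_continuous => x _.
  by have [] := D x.
have /andP[c0 ce] : 0 < c < e / 2 by rewrite in_itv in cI.
have := He c; rewrite /= sub0r normrN gtr0_norm // D10 subr0 addrC.
rewrite (lt_trans ce) ?ltr_pdivrMr ?ltr_pMr ?ltr1n //.
move=> /(_ isT (lt0r_neq0 c0)).
rewrite pmulr_rlt0 ?invr_gt0 // => Dneg.
have : F (e / 2) - F 0 < 0 by rewrite Fc subr0 pmulr_llt0.
rewrite subr_lt0 /F scale0r addr0 ltNge fmin //.
Qed.

End Minimum.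

Section Smooth.
Context {R : realType} {V W : normedModType R}.

Lemma Ck_cst k (c : W) : Ck k (cst c : V -> W).
Proof.
elim: k c => [|k IH] c /=; first by move=> x; exact: cst_continuous.
split=> [p|v]; first exact: differentiable_cst.
rewrite (_ : 'D_v _ = cst 0) //; apply/funext => p; exact: derive_cst.
Qed.

Lemma smooth_cst (c : W) : smooth (cst c : V -> W).
Proof. by move=> k; exact: Ck_cst. Qed.

Lemma CkD k (f g : V -> W) : Ck k f -> Ck k g -> Ck k (fun x => f x + g x).
Proof.
elim: k f g => [|k IH] f g /=.
  by move=> cf cg x; apply: cvgD; [exact: cf|exact: cg].
move=> [df Df] [dg Dg]; split=> [p|v]; first exact: differentiableD.
rewrite (_ : 'D_v _ = fun x => 'D_v f x + 'D_v g x); first exact: IH.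
by apply/funext => p; rewrite -deriveD //; exact: diff_derivable.
Qed.

Lemma smoothD (f g : V -> W) :
  smooth f -> smooth g -> smooth (fun x => f x + g x).
Proof. by move=> sf sg k; exact: CkD. Qed.

Lemma smooth_derivable (f : V -> W) p v : smooth f -> derivable f p v.
Proof. by move=> sf; have [df _] := sf 1%N; exact: diff_derivable. Qed.

Lemma smooth_continuous (f : V -> W) : smooth f -> continuous f.
Proof. by move=> sf; exact: (sf 0%N). Qed.

Lemma smooth_derive (f : V -> W) v : smooth f -> smooth ('D_v f).
Proof. by move=> sf k; have [_ Df] := sf k.+1; exact: Df. Qed.

End Smooth.

Section LinearCalculus.
Context {R : realType} {V W W' : normedModType R}.
Variables (l : W -> W') (l_lin : linear l) (l_cont : continuous l).

Lemma derive_linear_comp (f : V -> W) p v :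
  differentiable f p -> 'D_v (l \o f) p = l ('D_v f p).
Proof.
move=> df.
pose ll : {linear W -> W'} := HB.pack l (GRing.isLinear.Build _ _ _ _ _ l_lin).
have dl x : differentiable (ll : W -> W') x by exact: linear_differentiable.
rewrite !deriveE //; last exact: differentiable_comp (dl _).
by rewrite (diff_comp df (dl _)) /= (diff_lin (f := ll)).
Qed.

Lemma Ck_linear_comp k (f : V -> W) : Ck k f -> Ck k (l \o f).
Proof.
elim: k f => [|k IH] f /=.
  by move=> cf x; apply: continuous_comp; [exact: cf|exact: l_cont].
move=> [df Df].
pose ll : {linear W -> W'} := HB.pack l (GRing.isLinear.Build _ _ _ _ _ l_lin).
have dl x : differentiable (ll : W -> W') x by exact: linear_differentiable.
split=> [p|v]; first exact: differentiable_comp (dl _).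
rewrite (_ : 'D_v _ = l \o 'D_v f); first exact: IH.
by apply/funext => p; exact: derive_linear_comp.
Qed.

Lemma smooth_linear_comp (f : V -> W) : smooth f -> smooth (l \o f).
Proof. by move=> sf k; exact: Ck_linear_comp. Qed.

End LinearCalculus.

(** * Linear functionals, tensors and invariant functions *)

Lemma matrix_functional_continuous (R : realType) m n (l : 'M[R]_(m, n) -> R) :
  scalar l -> continuous l.
Proof.
move=> l_lin.
pose ll : {scalar 'M[R]_(m, n)} :=
  HB.pack l (GRing.isLinear.Build _ _ _ _ _ l_lin).
have -> : l = fun x => \sum_i \sum_j x i j * l (delta_mx i j).
  apply/funext => x.
  transitivity (ll (\sum_i \sum_j x i j *: delta_mx i j)).
    by rewrite -matrix_sum_delta.
  rewrite linear_sum; apply: eq_bigr => i _.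
  rewrite linear_sum; apply: eq_bigr => j _.
  exact: scalarZ.
move=> x; have xF := nbhs_filter x.
apply: cvg_big => [|i _]; first exact: add_continuous.
apply: cvg_big => [|j _]; first exact: add_continuous.
by apply: cvgM; [exact: coord_continuous|exact: cvg_cst].
Qed.

Section Group.
Context {R : realType} {m n : nat} (phi : 'cV[R]_m -> 'M[R]_n).
Local Notation G := (semidirect R m n).

Lemma functional_continuous (l : G -> R) : scalar l -> continuous l.
Proof.
move=> l_lin.
have l0 : l 0 = 0 by have := l_lin (-1) 0 0; rewrite scaler0 addr0 mulN1r addNr.
have E : l = fun x => l (x.1, 0) + l (0, x.2).
  apply/funext => x; rewrite -[RHS](congr1 (+%R^~ _) (mul1r _)) -l_lin.
  congr l; apply: injective_projections; rewrite /= scale1r ?addr0 ?add0r //.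
have c1 : continuous (fun x : 'cV[R]_m => l (x, 0)).
  apply: matrix_functional_continuous => a x y; rewrite -l_lin; congr l.
  by apply: injective_projections; rewrite /= ?scaler0 ?addr0.
have c2 : continuous (fun x : 'cV[R]_n => l (0, x)).
  apply: matrix_functional_continuous => a x y; rewrite -l_lin; congr l.
  by apply: injective_projections; rewrite /= ?scaler0 ?addr0.
rewrite E => x; apply: cvgD.
  apply: (@cvg_comp _ _ _ (@fst 'cV[R]_m 'cV[R]_n) (fun x => l (x, 0)) _
    (nbhs x.1)); [exact: cvg_fst|exact: c1].
apply: (@cvg_comp _ _ _ (@snd 'cV[R]_m 'cV[R]_n) (fun x => l (0, x)) _
  (nbhs x.2)); [exact: cvg_snd|exact: c2].
Qed.

(** A map on vector fields that is linear over smooth functions only sees the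
    value of the field at the point: expand the field in a constant basis and
    pull the coordinate functions out. Applied to a connection in its first
    argument, it replaces the field [J x] by a constant one. *)
Lemma tensorial (p : G) (T : (G -> G) -> G) :
  (forall (f : G -> R) (X X' : G -> G), smooth f -> smooth X -> smooth X' ->
     T (fun q => f q *: X q + X' q) = f p *: T X + T X') ->
  forall X : G -> G, smooth X -> T X = T (cst (X p)).
Proof.
move=> T_lin.
pose e := vbasis {:G}; pose c i (v : G) : R := coord e i v.
have c_lin i : scalar (c i) by move=> a u v; rewrite /c linearP.
have sc i X : smooth X -> smooth (fun q : G => c i (X q)).
  by apply: (smooth_linear_comp (c_lin i)); exact: functional_continuous.
have sce i X : smooth X -> smooth (fun q : G => c i (X q) *: e`_i).
  move=> sX; have := @smooth_linear_comp R G R^o G (fun a : R => a *: e`_i).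
  apply=> [a u v||]; first by rewrite scalerDl scalerA.
    exact: scalel_continuous.
  exact: sc.
have T0 : T (fun=> 0) = 0.
  have := T_lin (fun=> 1) (fun=> 0) (fun=> 0).
  rewrite scaler0 addr0 scale1r.
  move=> /(_ (smooth_cst _) (smooth_cst _) (smooth_cst _)).
  by move/eqP; rewrite -subr_eq0 opprD addNKr oppr_eq0 => /eqP.
have key s X : smooth X ->
    smooth (fun q => \sum_(i <- s) c i (X q) *: e`_i) /\
    T (fun q => \sum_(i <- s) c i (X q) *: e`_i)
    = \sum_(i <- s) c i (X p) *: T (cst e`_i).
  move=> sX; elim: s => [|i s [IHs IHT]].
    under eq_fun do rewrite big_nil; rewrite big_nil.
    by split=> //; exact: smooth_cst.
  under eq_fun do rewrite big_cons; rewrite big_cons; split.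
    by apply: smoothD => //; exact: sce.
  by rewrite (T_lin _ (cst e`_i)) ?IHT //; [exact: sc|exact: smooth_cst].
have TE X : smooth X -> T X = \sum_i c i (X p) *: T (cst e`_i).
  move=> sX; have [_ <-] := key (index_enum _) X sX; congr T.
  by apply/funext => q; exact: coord_vbasis (memvf _).
by move=> X sX; rewrite TE // [RHS]TE //; exact: smooth_cst.
Qed.

(** The function descends to the compact quotient by the lattice. *)
Lemma lattice_min (Gamma : set G) (f : G -> R) :
  lattice phi Gamma -> continuous f ->
  (forall a p, Gamma a -> f (smul phi a p) = f p) ->
  exists p, forall q, f p <= f q.
Proof.
move=> [[G0 GM GV] _ cG] cf finv.
pose Q := quotient_topology {eq_quot orbit_equiv phi Gamma}%qT.
have fpi : {homo f : a b / (\pi_Q a == \pi_Q b)%qT >-> a == b}.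
  move=> a b /eqP/eqmodP /eqP ab.
  have : (smul phi^~ a @` Gamma) (smul phi 0 a) by exists 0.
  by rewrite ab => -[c Gc] /(congr1 f); rewrite !finv // => ->.
have cfr := repr_comp_continuous cf fpi.
have fE a : (f \o repr) (\pi_Q a)%qT = f a.
  by apply/eqP; apply: fpi; rewrite reprK.
have [|c _ cmin] := @compact_EVT_min _ R _ _ _ cG (continuous_subspaceT cfr).
  by exists (\pi_Q 0)%qT.
by exists (repr c) => q; rewrite -(fE q); apply: cmin; rewrite inE.
Qed.
End Group.

Lemma riesz (R : realType) (V : vectType R) (g : V -> V -> R) (l : V -> R) :
  (forall u, scalar (g u)) -> (forall u v, g u v = g v u) ->
  (forall u, u != 0 -> 0 < g u u) -> scalar l ->
  exists B, forall u, g B u = l u.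
Proof.
move=> g_lin g_sym g_pos l_lin.
pose e := vbasis {:V}.
have basisE (h h' : V -> R) : scalar h -> scalar h' ->
    (forall i : 'I_(\dim {:V}), h e`_i = h' e`_i) -> forall u, h u = h' u.
  move=> hl h'l hh' u.
  pose H : {scalar V} := HB.pack h (GRing.isLinear.Build _ _ _ _ _ hl).
  pose H' : {scalar V} := HB.pack h' (GRing.isLinear.Build _ _ _ _ _ h'l).
  rewrite -[h u]/(H u) -[h' u]/(H' u) (coord_vbasis (memvf u)) !linear_sum.
  by apply: eq_bigr => i _; rewrite !scalarZ; congr (_ * _); exact: hh'.
pose F u : 'rV[R]_(\dim {:V}) := \row_i g u e`_i.
have F_lin : linear F.
  by move=> a u v; apply/rowP => i; rewrite !mxE !(g_sym _ e`_i) g_lin.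
pose Fl : {linear V -> 'rV[R]_(\dim {:V})} :=
  HB.pack F (GRing.isLinear.Build _ _ _ _ _ F_lin).
pose f := linfun Fl.
have kf : lker f == 0%VS.
  rewrite -subv0; apply/subvP => u; rewrite memv_ker lfunE /= memv0 => /eqP F0.
  apply: contraT => /g_pos.
  rewrite (basisE (g u) (fun=> 0)) ?ltxx // => [a x y|i].
    by rewrite mulr0 addr0.
  by have /rowP/(_ i) := F0; rewrite !mxE.
have fT : limg f = fullv.
  apply/eqP; rewrite eqEdim subvf limg_dim_eq ?(eqP kf) ?capv0 //.
  rewrite [X in (X <= _)%N]dimvf dim_matrix mul1r.
  exact: leqnn.
have : (\row_i l e`_i) \in limg f by rewrite fT memvf.
move=> /memv_imgP[B _ /rowP BE]; exists B; apply: basisE => // i.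
by have := BE i; rewrite lfunE !mxE.
Qed.

(** * The covariant derivative of the complex structure *)

(** The tensor [A a x] stands for the covariant derivative of [J] in the
    direction [a], applied to [x], at one point. *)
Section HermitianAlgebra.
Context {R : realType} {V : lmodType R}.
Variables (g : V -> V -> R) (J : V -> V) (A : V -> V -> V).
Hypotheses (g_lin : forall u, scalar (g u)) (g_sym : forall u v, g u v = g v u).
Hypothesis JJ : forall u, J (J u) = - u.
Hypothesis gJ : forall u v, g (J u) (J v) = g u v.
Hypothesis A_skew : forall a x y, g (A a x) y = - g (A a y) x.
Hypothesis A_skewJ : forall a x y, g (A a x) (J y) = - g (A a y) (J x).
Hypothesis A_integrable :
  forall y z, A (J y) z - A (J z) y = J (A y z - A z y).

(* For a torsion-free metric connection, the exterior derivative of the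
   fundamental form is the cyclic sum of the covariant derivatives of [J]. *)
Let dom u v w := g (A u w) v + g (A v u) w + g (A w v) u.

Let g0r u : g u 0 = 0.
Proof. by have := g_lin u (-1) 0 0; rewrite scaler0 addr0 mulN1r addNr. Qed.
Let gNr u v : g u (- v) = - g u v.
Proof.
by have := g_lin u (-1) v 0; rewrite scaleN1r !addr0 mulN1r g0r addr0.
Qed.
Let gNl u v : g (- u) v = - g u v.
Proof. by rewrite g_sym gNr g_sym. Qed.
Let gBl u v w : g (u - v) w = g u w - g v w.
Proof.
rewrite !(g_sym _ w); have := g_lin w 1 u (- v).
by rewrite scale1r mul1r gNr.
Qed.

(** The classical formula expressing the covariant derivative of an integrable
    [J] through the exterior derivative of the fundamental form: the terms
    differentiated along [J y] and [J z] are turned by integrability into terms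
    differentiated along [y] and [z], which cancel. *)
Lemma nablaJ_dOmega u y z : dom u (J y) (J z) - dom u y z = - 2 * g (A u z) y.
Proof.
have E1 : g (A u (J z)) (J y) = - g (A u z) y.
  by rewrite A_skewJ JJ gNr opprK A_skew.
have E2 : g (A (J y) u) (J z) + g (A (J z) (J y)) u
        = - g (A y z) u + g (A z y) u.
  rewrite A_skewJ [in X in _ + X]A_skew [in X in _ - X]A_skewJ opprK.
  by rewrite -[LHS]opprK opprD opprK -gBl A_integrable gJ gBl opprB addrC.
by rewrite /dom E1 [g (A y u) z]A_skew; move: E2; lra.
Qed.

(** With the locally conformally Kähler condition, the previous formula gives
    the component of the covariant derivative of [J] along the Lee vector [B] as
    an expression antisymmetric in [u] and [v]. *)
Lemma lee_nablaJ (theta : V -> R) (B : V) :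
  (forall u, g B u = theta u) ->
  (forall u v w, dom u v w =
     theta u * g v (J w) - theta v * g u (J w) + theta w * g u (J v)) ->
  forall u v, g (A u v) B - g (A v u) B =
    theta u * theta (J v) - theta v * theta (J u) - theta B * g u (J v).
Proof.
move=> thE domE.
have gJl u v : g u (J v) = - g (J u) v.
  by rewrite -gJ JJ gNr.
have thJB : theta (J B) = 0.
  by have := gJl B B; rewrite (g_sym (J B)) thE => e; lra.
have half u v : 2 * g (A u v) B =
    theta u * theta (J v) - theta v * theta (J u) - theta B * g u (J v).
  have JBv : g (J B) v = - theta (J v) by rewrite -thE gJl opprK.
  have uJB : g u (J B) = - theta (J u) by rewrite gJl g_sym thE.
  have := nablaJ_dOmega u B v.
  by rewrite !domE thJB !JJ !gNr JBv uJB (g_sym u B) !thE; lra.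
move=> u v; have := half u v; have := half v u.
by rewrite (gJl v u) (g_sym _ u) => e1 e2; lra.
Qed.

End HermitianAlgebra.

Lemma zmod_rearrange (V : zmodType) (a b c d e f h i : V) :
  a - b + (c - d) + (e - f) - (h - i) = 0 ->
  (h - c) - (i - f) = (e + a) - (d + b).
Proof.
move=> /subr0_eq S; have -> : (h - c) - (i - f) = (h - i) - (c - f).
  by rewrite !opprB -!addrA; congr (h + _); rewrite addrC -addrA addrCA.
rewrite -S opprB -addrA [e - f + _]addrA subrK.
rewrite -addrA [c - d + _]addrC [e - c + _]addrA subrK.
by rewrite addrACA opprD [a + e]addrC [- b + _]addrC.
Qed.

Section LeeForm.
Context {R : realType} {m n : nat}.
Local Notation G := (semidirect R m n).
Variables (J : G -> G -> G) (g : G -> G -> G -> R).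
Variables (nabla : (G -> G) -> (G -> G) -> G -> G) (theta : G -> G -> R).
Hypothesis J_cplx : complex_structure J.
Hypothesis g_metric : riemannian_metric g.
Hypothesis gJ : forall p u v, g p (J p u) (J p v) = g p u v.
Hypothesis LC : levi_civita g nabla.
Hypothesis theta_parallel : parallel_form1 nabla theta.
Hypothesis dOmega : forall p u v w,
  ext_d2 (fundamental_form J g) p u v w
  = wedge12 theta (fundamental_form J g) p u v w.

(** On a Vaisman manifold, the exterior derivative of [theta \o J] is
    [theta /\ (theta \o J) - |B|^2 omega], where [B] is dual to the Lee form
    [theta]. As [theta] is parallel, that derivative is [theta] applied to the
    skew part of the covariant derivative of [J], given by [lee_nablaJ]. The
    tensor is computed on constant fields; integrability is the only place where
    a derivative along the field [J x] arises. *)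
Lemma vaisman_dthetaJ p B u v : (forall w, g p B w = theta p w) ->
  'D_u (fun q => theta q (J q v)) p - 'D_v (fun q => theta q (J q u)) p
  = theta p u * theta p (J p v) - theta p v * theta p (J p u)
    - theta p B * g p u (J p v).
Proof.
move=> thE.
have [J_lin J_smooth JJ nij] := J_cplx.
have [g_lin g_sym _ _] := g_metric.
have [[_ nablaZ _ nablaL] torsion compat] := LC.
have JB q x y : J q (x - y) = J q x - J q y.
  by have := J_lin q (-1) y x; rewrite !scaleN1r ![- _ + _]addrC.
have gB q x y z : g q x (y - z) = g q x y - g q x z.
  by have := g_lin q x (-1) z y; rewrite scaleN1r mulN1r ![- _ + _]addrC.
have gBl q x y z : g q (y - z) x = g q y x - g q z x.
  by rewrite !(g_sym q _ x) gB.
have Jsm x : smooth (fun q => J q x) by exact: J_smooth.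
have csm (x : G) : smooth (cst x : G -> G) by exact: smooth_cst.
pose N a x := nabla (cst a) (cst x) p.
pose NJ a x := nabla (cst a) (J^~ x) p.
pose A a x := NJ a x - J p (N a x).
have tens x Y : smooth Y -> nabla (J^~ x) Y p = nabla (cst (J p x)) Y p.
  move=> sY; apply: (@tensorial R m n p (fun X => nabla X Y p)) => //.
  by move=> f X X' sf sX sX'; exact: nablaZ.
have NC x y : N x y = N y x.
  apply/eqP; rewrite -subr_eq0 /N torsion // /lie_bracket !derive_cst subrr //.
have comp a x y : 'D_a (fun q => g q x y) p = g p (N a x) y + g p x (N a y).
  exact: (compat (cst a) (cst x) (cst y)).
have compJr a x y : 'D_a (fun q => g q x (J q y)) p
    = g p (N a x) (J p y) + g p x (NJ a y).
  exact: (compat (cst a) (cst x) (J^~ y)).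
have compJl a x y : 'D_a (fun q => g q (J q x) y) p
    = g p (NJ a x) y + g p (J p x) (N a y).
  exact: (compat (cst a) (J^~ x) (cst y)).
have compJJ a x y : 'D_a (fun q => g q (J q x) (J q y)) p
    = g p (NJ a x) (J p y) + g p (J p x) (NJ a y).
  exact: (compat (cst a) (J^~ x) (J^~ y)).
have g0 q x : g q x 0 = 0 by rewrite -[X in g q x X](subrr 0) gB subrr.
have gN q x y : g q x (- y) = - g q x y by rewrite -sub0r gB g0 sub0r.
have J0 q : J q 0 = 0 by rewrite -[X in J q X](subrr 0) JB subrr.
have JN q x : J q (- x) = - J q x by rewrite -[in LHS]sub0r JB J0 sub0r.
have gNl q x y : g q (- x) y = - g q x y by rewrite !(g_sym q _ y) gN.
have gJl q x y : g q x (J q y) = - g q (J q x) y by rewrite -gJ JJ gN.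
(* The skewness rules differentiate the Hermitian condition along [a]. *)
have A_skew a x y : g p (A a x) y = - g p (A a y) x.
  (* Differentiate the equality of g (J (- x)) y and g x (J y): with the sign
     inside the field, no derivative of an opposite function is taken. *)
  have NJN : NJ a (- x) = - NJ a x.
    rewrite /NJ (_ : J^~ (- x) = fun q => (-1) *: J q x); last first.
      by apply/funext => q; rewrite JN scaleN1r.
    rewrite (nablaL (fun=> -1)) //; last exact: smooth_cst.
    by rewrite derive_cst scale0r addr0 scaleN1r.
  have : 'D_a (fun q => g q (J q (- x)) y) p = 'D_a (fun q => g q x (J q y)) p.
    by congr ('D_a _ p); apply/funext => q; rewrite gJl JN gNl.
  rewrite compJr compJl NJN JN /A !gNl !gBl gJl.
  have := gJl p x (N a y); rewrite (g_sym p x (J p _)) (g_sym p x (NJ a y)).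
  lra.
have A_skewJ a x y : g p (A a x) (J p y) = - g p (A a y) (J p x).
  have : 'D_a (fun q => g q (J q x) (J q y)) p = 'D_a (fun q => g q x y) p.
    by congr ('D_a _ p); apply/funext => q; rewrite gJ.
  rewrite compJJ comp /A !gBl !gJ (g_sym p x) (g_sym p (J p x)); lra.
have A_int y z : A (J p y) z - A (J p z) y = J p (A y z - A z y).
  have nij_yz : lie_bracket (cst y) (cst z) p
    + J p (lie_bracket (J^~ y) (cst z) p)
    + J p (lie_bracket (cst y) (J^~ z) p) - lie_bracket (J^~ y) (J^~ z) p = 0.
    exact: (nij (cst y) (cst z) (csm y) (csm z) p).
  move: nij_yz; rewrite -!torsion // !tens // !JB !JJ !opprK -/(N _ _).
  exact: zmod_rearrange.
have dO a x y : g p (A a y) x + g p (A x a) y + g p (A y x) a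
   = theta p a * g p x (J p y) - theta p x * g p a (J p y)
     + theta p y * g p a (J p x).
  have := dOmega p a x y; rewrite /wedge12 /ext_d2 /fundamental_form => <-.
  rewrite !compJr (g_sym p x (NJ a y)).
  rewrite (g_sym p a (NJ x y)) (g_sym p a (NJ y x)).
  rewrite (A_skew x a) /A !gBl (NC x a) (NC y a) (NC y x) (gJl p (N a y)).
  lra.
have par a x : 'D_a (fun q => theta q (J q x)) p = theta p (NJ a x).
  apply/eqP; rewrite -subr_eq0; apply/eqP.
  exact: (theta_parallel (csm a) (Jsm x) p).
have := lee_nablaJ (g_lin p) (g_sym p) (JJ p) (gJ p) A_skew A_skewJ A_int
  thE dO.
move=> <-; rewrite !par -!thE /A !(g_sym p _ B) !gB NC.
by lra.
Qed.

End LeeForm.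

(** * Left-invariant tensors and the commutator subgroup *)

Section Invariant.
Context {R : realType} {m n : nat} (phi : 'cV[R]_m -> 'M[R]_n).
Local Notation G := (semidirect R m n).
Hypothesis hphi : lie_action phi.

Lemma smulr0 (a : G) : smul phi a 0 = a.
Proof. by case: a => a1 a2; rewrite /smul /= addr0 mulmx0 addr0. Qed.

(** The value at [p] of the left-invariant vector field equal to [u] at the
    identity. *)
Definition left_translate (p u : G) : G := (u.1, phi p.1 *m u.2).

Lemma dtransE a p u : dtrans phi a p u = left_translate a u.
Proof.
apply: derive_affine => s; apply: injective_projections => /=.
  by rewrite addrA.
by rewrite mulmxDr -scalemxAr addrA.
Qed.

Lemma invariant_form1_eval (alpha : G -> G -> R) p u :
  invariant_form1 phi setT alpha -> alpha p (left_translate p u) = alpha 0 u.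
Proof. by move=> /(_ p 0 u I); rewrite smulr0 dtransE. Qed.

Lemma invariant_endo_eval (J : G -> G -> G) p u :
  left_invariant_endo phi J ->
  J p (left_translate p u) = left_translate p (J 0 u).
Proof. by move=> /(_ p 0 u); rewrite smulr0 !dtransE. Qed.

Lemma left_translateK (p u : G) :
  left_translate p (u.1, invmx (phi p.1) *m u.2) = u.
Proof.
have [_ phiU _] := hphi.
by case: u => u1 u2; rewrite /left_translate /= mulKVmx.
Qed.

(** A closed left-invariant form kills the brackets of [R^m] with [R^n], so its
    restriction to [R^n] is fixed by the action: in coordinates, its value on a
    constant field tangent to [R^n] is constant along [R^m], because the
    form takes a constant value on the field [(t, 0)]. *)
Lemma closed_invariant_fix (alpha : G -> G -> R) t y :
  closed_form1 phi setT alpha -> alpha 0 (0, phi t *m y) = alpha 0 (0, y).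
Proof.
move=> [[al_lin al_smooth] al_inv al_closed].
pose F (s : R) := alpha ((0 : G) + s *: ((t, 0) : G)) (0, phi t *m y).
have DF (s : R) : is_derive s 1 F 0.
  have := is_derive_line (smooth_derivable (p := 0 + s *: ((t, 0) : G))
    (v := (t, 0)) (al_smooth (0, phi t *m y))).
  have := al_closed (0 + s *: ((t, 0) : G)) (t, 0) (0, phi t *m y).
  rewrite /ext_d1 => /subr0_eq ->.
  rewrite (_ : 'D_ _ _ _ = 0) //; apply: derive_affine => r.
  rewrite scaler0 addr0.
  have E q : alpha q (t, 0) = alpha 0 (t, 0).
    by rewrite -(invariant_form1_eval q _ al_inv) /left_translate /= mulmx0.
  by rewrite E [RHS]E.
have := is_derive_0_is_cst 1 0 DF.
rewrite /F scale0r addr0 add0r scale1r => <-.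
exact: invariant_form1_eval (t, 0) (0, y) al_inv.
Qed.

(** By the previous lemma, the [R^n]-part of the form is a group homomorphism
    from the semidirect product to the reals. *)
Lemma invariant_form_commutator (alpha : G -> G -> R) p :
  closed_form1 phi setT alpha -> commutator_subgroup phi p ->
  alpha 0 (0, p.2) = 0.
Proof.
move=> al_closed; have fix_al t y := closed_invariant_fix t y al_closed.
have [[al_lin _] _ _] := al_closed.
pose L (q : G) := alpha 0 (0, q.2).
have LD x y : alpha 0 (0, x + y) = alpha 0 (0, x) + alpha 0 (0, y).
  have := al_lin 0 1 (0, x) (0, y); rewrite mul1r scale1r => <-.
  by congr alpha; apply: injective_projections; rewrite /= ?addr0.
have LN x : alpha 0 (0, - x) = - alpha 0 (0, x).
  have L0 : alpha 0 (0, 0) = 0 by have := LD 0 0; rewrite addr0; lra.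
  by have := LD x (- x); rewrite subrr L0; lra.
have LM a b : L (smul phi a b) = L a + L b by rewrite /L /= LD fix_al.
have LV a : L (sinv phi a) = - L a by rewrite /L /= LN fix_al.
move=> /(_ [set q | L q = 0]); apply.
  split=> [|a b La Lb|a La] /=.
  - by have := LM 0 0; rewrite smulr0; lra.
  - by rewrite LM La Lb addr0.
  - by rewrite LV La oppr0.
by move=> a b; rewrite /scomm /= !LM !LV; lra.
Qed.

Lemma lie_functional (H : set G) (l : G -> R) X :
  scalar l -> (forall p, H p -> l p = 0) -> lie_of_subgroup phi H X -> l X = 0.
Proof.
move=> l_lin lH [c [c_smooth _ cH <-]].
rewrite -(@derive_linear_comp R R^o G R^o l) //; last 2 first.
- exact: functional_continuous.
- by have [] := c_smooth 1%N.
rewrite (_ : l \o c = cst 0); first exact: derive_cst.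
by apply/funext => t /=; rewrite lH.
Qed.

Lemma lie_commutator_fst X :
  lie_of_subgroup phi (commutator_subgroup phi) X -> X.1 = 0.
Proof.
move=> lX; apply/matrixP => i j; rewrite mxE.
apply: (lie_functional (l := fun p : G => p.1 i j) _ _ lX).
  by move=> a u v; rewrite /= !mxE.
move=> p /(_ [set q | q.1 = 0]) /= ->; first by rewrite mxE.
  by split=> //= [a b -> ->|a ->]; rewrite ?addr0 ?oppr0.
by move=> a b; rewrite /= addrACA !subrr addr0.
Qed.

Lemma lie_commutator_form (alpha : G -> G -> R) X :
  closed_form1 phi setT alpha ->
  lie_of_subgroup phi (commutator_subgroup phi) X -> alpha 0 X = 0.
Proof.
move=> al_closed lX; have [[al_lin _] _ _] := al_closed.
rewrite (surjective_pairing X) (lie_commutator_fst lX).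
apply: (lie_functional (l := fun p : G => alpha 0 (0, p.2)) _ _ lX).
  move=> a u v /=; rewrite -al_lin; congr alpha.
  by apply: injective_projections; rewrite /= ?scaler0 ?addr0.
by move=> p /(invariant_form_commutator al_closed).
Qed.

(** A subspace of more than half the dimension meets its image under [J]. *)
Lemma stable_pair (J : G -> G) (U : {vspace G}) :
  linear J -> (forall u, J (J u) = - u) -> (m + n < 2 * \dim U)%N ->
  exists X, [/\ X \in U, J X \in U & X != 0].
Proof.
move=> J_lin JJ dU.
pose Jl : {linear G -> G} := HB.pack J (GRing.isLinear.Build _ _ _ _ _ J_lin).
pose f := linfun Jl.
have fE u : f u = J u by rewrite lfunE.
have kf : lker f == 0%VS.
  apply/lker0P => u v; rewrite !fE => /(congr1 J); rewrite !JJ; exact: oppr_inj.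
have df : \dim (f @: U) = \dim U by rewrite limg_dim_eq // (eqP kf) capv0.
have dG : \dim {:G} = (m + n)%N.
  by rewrite dimvf -[RHS]/(m + n)%N -[in RHS](muln1 m) -[in RHS](muln1 n).
have : (U :&: f @: U)%VS != 0%VS.
  apply/eqP => cap0; have := dimv_sum_cap U (f @: U).
  rewrite cap0 dimv0 addn0 df addnn -mul2n => E.
  by have := dimvS (subvf (U + f @: U)%VS); rewrite dG E leqNgt dU.
rewrite -vpick0 => Z0; have := memv_pick (U :&: f @: U).
rewrite memv_cap => /andP[ZU /memv_imgP[X XU ZE]].
exists X; split=> //; first by rewrite -fE -ZE.
by apply: contraNneq Z0 => X0; rewrite ZE X0 linear0.
Qed.

End Invariant.

(** * Comparison of the first cohomology groups *)

(** In a quotient [Z / B] of dimension [k], any [k] independent classes span: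
    their matrix in a given basis of classes is invertible. *)
Lemma quotient_dim_span (R : realType) (V : lmodType R) (Z B : set V) k
    (e : 'I_k -> V) :
  B 0 -> (forall (a : R) x y, B x -> B y -> B (a *: x + y)) ->
  has_quotient_dim Z B k -> (forall i, Z (e i)) ->
  (forall c : 'I_k -> R, B (\sum_i c i *: e i) -> forall i, c i = 0) ->
  forall z, Z z -> exists c : 'I_k -> R, B (z - \sum_i c i *: e i).
Proof.
move=> B0 B_lin [d [_ d_indep d_span]] eZ e_indep z Zz.
have B_comb (c : 'I_k -> R) x : (forall i, B (x i)) -> B (\sum_i c i *: x i).
  move=> Bx; elim/big_rec: _ => // i y _; exact: B_lin.
have BD x y : B x -> B y -> B (x + y).
  by rewrite -{2}(scale1r x); exact: B_lin.
have BN x : B x -> B (- x).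
  by move=> Bx; rewrite -scaleN1r -[_ *: x]addr0; exact: B_lin.
have [M eM] : exists M : 'M[R]_k, forall i, B (e i - \sum_j M i j *: d j).
  have [F HF] := choice (fun i => d_span _ (eZ i)).
  by exists (\matrix_(i, j) F i j) => i; under eq_bigr do rewrite mxE.
have comb (c : 'rV[R]_k) : \sum_i c 0 i *: (e i - \sum_j M i j *: d j)
    = \sum_i c 0 i *: e i - \sum_j (c *m M) 0 j *: d j.
  under eq_bigr do rewrite scalerBr; rewrite sumrB; congr (_ - _).
  under eq_bigr do rewrite scaler_sumr; rewrite exchange_big /=.
  apply: eq_bigr => j _; rewrite mxE scaler_suml.
  by under eq_bigr do rewrite scalerA.
have Mu : M \in unitmx.
  rewrite -row_free_unit; apply: inj_row_free => v vM0.
  have := B_comb (v 0) _ eM; rewrite comb vM0.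
  under [X in _ - X]eq_bigr do rewrite mxE scale0r.
  rewrite big1_eq subr0 => /e_indep v0.
  by apply/rowP => i; rewrite v0 mxE.
have [a aP] := d_span z Zz.
pose c := (\row_j a j) *m invmx M; exists (c 0).
have := BD _ _ aP (BN _ (B_comb (c 0) _ eM)).
rewrite comb mulmxKV //.
rewrite opprB addrA.
under [X in _ + X - _]eq_bigr do rewrite mxE.
by rewrite subrK.
Qed.

Section Cohomology.
Context {R : realType} {m n : nat} (phi : 'cV[R]_m -> 'M[R]_n).
Local Notation G := (semidirect R m n).
Hypothesis hphi : lie_action phi.

Lemma exact_form1_0 (Gamma : set G) : exact_form1 phi Gamma (0 : G -> G -> R^o).
Proof.
exists (cst 0); split=> //; first exact: smooth_cst.
by move=> p u; rewrite derive_cst.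
Qed.

Lemma exact_form1_lin (Gamma : set G) (a : R) (x y : G -> G -> R^o) :
  exact_form1 phi Gamma x -> exact_form1 phi Gamma y ->
  exact_form1 phi Gamma (a *: x + y).
Proof.
move=> [f [sf fi fE]] [h [sh hi hE]].
have al : linear (fun x : R => a * x).
  by move=> r u v; rewrite mulrDr mulrCA.
have ac : continuous (fun x : R => a * x) by exact: mulrl_continuous.
have saf : smooth (fun q => a * f q) := smooth_linear_comp al ac sf.
exists (fun q => a * f q + h q); split=> [|b p Gb|p u].
- exact: smoothD.
- by rewrite fi // hi.
rewrite (deriveD (smooth_derivable saf) (smooth_derivable sh)).
rewrite (derive_linear_comp al ac) ?fctE /=; last by have [] := sf 1%N.
by rewrite -fE -hE.
Qed.

(** The differential of an invariant function vanishes where that function is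
    minimal, and a left-invariant form vanishing at one point is zero. So the
    cohomology of left-invariant 1-forms embeds in that of the quotient. *)
Lemma invariant_exact_eq0 (Gamma : set G) (alpha : G -> G -> R^o) :
  lattice phi Gamma ->
  (forall p u, alpha p (left_translate phi p u) = alpha 0 u) ->
  exact_form1 phi Gamma alpha -> alpha = 0.
Proof.
move=> hG al_inv [f [sf fi fE]].
have [p pmin] := lattice_min hG (smooth_continuous sf) fi.
have al0 u : alpha 0 u = 0.
  rewrite -(al_inv p) fE; apply: derive_min => // q; exact: smooth_derivable.
apply/funext => q; apply/funext => u.
by rewrite -(left_translateK hphi q u) al_inv al0.
Qed.

(** The embedding of left-invariant cohomology into that of the quotient is
    onto, since both have dimension [b]: every closed form is a left-invariant
    closed form plus the differential of an invariant function. *)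
Lemma cohomologous_invariant (Gamma : set G) b (theta : G -> G -> R) :
  lattice phi Gamma -> betti1 phi Gamma b -> betti1 phi setT b ->
  closed_form1 phi Gamma theta ->
  exists k (c : 'I_k -> R) (e : 'I_k -> G -> G -> R^o) (f : G -> R),
    [/\ forall i, closed_form1 phi setT (e i), smooth f,
        forall a p, Gamma a -> f (smul phi a p) = f p &
        forall p u, theta p u = \sum_i c i * e i p u + 'D_u f p].
Proof.
move=> hG hb [e [eZ e_indep _]] thZ.
have combE (c : 'I_b -> R) p u :
    (\sum_i c i *: e i) p u = \sum_i c i * e i p u by rewrite !fct_sumE.
have e_inv i p u : e i p (left_translate phi p u) = e i 0 u.
  by have [_ ei_inv _] := eZ i; exact: invariant_form1_eval.
have eZG i : closed_form1 phi Gamma (e i).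
  by have [e1 e2 e3] := eZ i; split=> // a p u _; exact: e2.
have e_indepG (c : 'I_b -> R) :
    exact_form1 phi Gamma (\sum_i c i *: e i) -> forall i, c i = 0.
  move=> /(invariant_exact_eq0 hG) E; apply: e_indep; rewrite E.
    exact: exact_form1_0.
  by move=> p u; rewrite !combE; under eq_bigr do rewrite e_inv.
have [c [f [sf fi fE]]] := quotient_dim_span (exact_form1_0 Gamma)
  (@exact_form1_lin Gamma) hb eZG e_indepG thZ.
exists b, c, e, f; split=> // p u.
by rewrite -fE -combE addrC; apply/esym; exact: subrK.
Qed.

End Cohomology.

(** * Nonexistence of Vaisman metrics *)

Theorem theorem1p1 (R : realType) (m n : nat) (phi : 'cV[R]_m -> 'M[R]_n)
  (hphi : lie_action phi) (hss : semisimple_action phi)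
  (k : nat) (hk : lie_subgroup_dim phi (commutator_subgroup phi) k)
  (hdim : (m + n < 2 * k)%N)
  (Gamma : set (semidirect R m n)) (hGamma : lattice phi Gamma)
  (J : semidirect R m n -> semidirect R m n -> semidirect R m n)
  (hJ : complex_structure J) (hJinv : left_invariant_endo phi J)
  (b : nat) (hb : betti1 phi Gamma b) (hbg : betti1 phi [set: semidirect R m n] b) :
  ~ exists g : semidirect R m n -> semidirect R m n -> semidirect R m n -> R,
      vaisman_metric phi Gamma J g.
Proof.
move=> [g [theta [nabla [[[g_metric _ gJ] th_closed _ th_nex dO] LC par]]]].
have [J_lin _ JJ _] := hJ.
have [g_lin g_sym g_pos _] := g_metric.
have [[th_lin _] _ _] := th_closed.
have [d [c [e [f [eZ sf finv thE]]]]] :=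
  cohomologous_invariant hphi hGamma hb hbg th_closed.
pose theta0 q u := \sum_i c i * e i q u.
have th0_inv q u : theta0 q (left_translate phi q u) = theta0 0 u.
  by apply: eq_bigr => i _; have [_ ei _] := eZ i; rewrite invariant_form1_eval.
have [U UE dU] := hk.
have th0_U X : X \in U -> theta0 0 X = 0.
  move=> /UE lX; rewrite /theta0 big1 // => i _.
  by rewrite (lie_commutator_form (eZ i) lX) mulr0.
have U_fst X : X \in U -> X.1 = 0 by move=> /UE /lie_commutator_fst.
have [X [XU JXU X0]] : exists X, [/\ X \in U, J 0 X \in U & X != 0].
  by apply: stable_pair => //; rewrite dU.
(* At a minimum [p] of [f], the Lee form agrees with its left-invariant part. *)
have [p pmin] := lattice_min hGamma (smooth_continuous sf) finv.
have df q u : derivable f q u by exact: smooth_derivable.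
have d2f q u : derivable ('D_u f) q u.
  by apply: smooth_derivable; exact: smooth_derive.
have df0 u : 'D_u f p = 0 by exact: derive_min.
pose u := left_translate phi p X; pose v := left_translate phi p (J 0 X).
(* Left-invariant fields are constant along the directions [u] and [v], which
   are tangent to [R^n]; so on the lines through [p] that matter, [J] maps the
   constant field [u] to [v] and [v] to [- u], and the invariant part of the
   Lee form vanishes on both. *)
have slice Y s q : Y \in U -> q = p + s *: left_translate phi p Y ->
    left_translate phi q = left_translate phi p.
  move=> YU ->; apply/funext => w; rewrite /left_translate /=.
  by rewrite (U_fst Y YU) scaler0 addr0.
have th_u q : left_translate phi q = left_translate phi p ->
    theta q u = 'D_u f q.
  by move=> qp; rewrite thE -/(theta0 q u) /u -qp th0_inv th0_U // add0r.
have th_v q : left_translate phi q = left_translate phi p ->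
    theta q v = 'D_v f q.
  by move=> qp; rewrite thE -/(theta0 q v) /v -qp th0_inv th0_U // add0r.
have Ju q : left_translate phi q = left_translate phi p -> J q u = v.
  by move=> qp; rewrite /u /v -qp; exact: invariant_endo_eval.
have Jv q : left_translate phi q = left_translate phi p -> J q v = - u.
  by move=> qp; rewrite -(Ju q qp) JJ.
have thN q w : theta q (- w) = - theta q w.
  have th00 : theta q 0 = 0.
    by have := th_lin q (-1) 0 0; rewrite scaler0 addr0 mulN1r addNr.
  by have := th_lin q (-1) w 0; rewrite scaleN1r !addr0 th00 mulN1r addr0.
have [B BE] := riesz (g_lin p) (g_sym p) (g_pos p) (th_lin p).
(* The identity reads: minus the sum of the second derivatives of [f] along [u]
   and [v] equals |B|^2 |u|^2. *)
have := vaisman_dthetaJ hJ g_metric gJ LC par dO u v BE.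
rewrite th_u // th_v // !df0 !mul0r subrr sub0r Jv //.
have -> : 'D_u (fun q => theta q (J q v)) p = - 'D_u ('D_u f) p.
  rewrite -deriveN //; apply: derive_line_eq => s.
  by rewrite Jv ?thN ?th_u //; exact: slice XU _.
have -> : 'D_v (fun q => theta q (J q u)) p = 'D_v ('D_v f) p.
  apply: derive_line_eq => s.
  by rewrite Ju ?th_v //; exact: slice JXU _.
have guN : g p u (- u) = - g p u u.
  have g00 : g p u 0 = 0.
    by have := g_lin p u (-1) 0 0; rewrite scaler0 addr0 mulN1r addNr.
  by have := g_lin p u (-1) u 0; rewrite scaleN1r !addr0 g00 mulN1r addr0.
have u_neq0 : u != 0.
  apply: contra X0 => /eqP u0; apply/eqP.
  apply: injective_projections; first exact: U_fst.
  have /(congr1 (mulmx (invmx (phi p.1)))) : phi p.1 *m X.2 = 0.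
    exact: (congr1 snd u0).
  by have [_ phiU _] := hphi; rewrite mulKmx // mulmx0.
(* If the Lee form vanished at [p], its left-invariant part would be zero and
   the Lee form would be exact. *)
have B_neq0 : B != 0.
  apply/eqP => B0; apply: th_nex; exists f; split=> // q w.
  have thp w' : theta p w' = 0.
    rewrite -BE B0 g_sym.
    by have := g_lin p w' (-1) 0 0; rewrite scaler0 addr0 mulN1r addNr.
  have th0p w' : theta0 p w' = 0 by rewrite -(thp w') thE df0 addr0.
  rewrite thE -/(theta0 q w) -[in theta0 q w](left_translateK hphi q w).
  by rewrite th0_inv -(th0_inv p) th0p add0r.
have := derive2_min (df^~ u) (d2f^~ u) pmin.
have := derive2_min (df^~ v) (d2f^~ v) pmin.
have := mulr_gt0 (g_pos p B B_neq0) (g_pos p u u_neq0).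
rewrite guN mulrN opprK -BE.
move: (g p B B * g p u u) ('D_u ('D_u f) p) ('D_v ('D_v f) p) => a x y.
by clear; lra.
Qed.
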